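(* Let $r\in[2,\infty)$ and let $(X,\|\cdot\|)$ be an $r$-uniformly convex space with constant $c_r$. Let $T_1,T_2,\dots,T_n:X\to X$ be operators such that $T_i$ is $\alpha$-firmly nonexpansive with constant $\alpha_i\in(0,1)$, $i=1,\dots,n$, and let $w_i\in[0,1]$, $i=1,\dots,n$, with $\sum_{i=1}^nw_i=1$. Put $\alpha_{\max}:=\max\{\alpha_i:i=1,\dots,n\}$. Then the following relations hold true: i) the operator $T:=\sum_{i=1}^nw_iT_i$ is $\alpha$-firmly nonexpansive with constant $\alpha=\alpha_{\max}$; ii) the operator $T:=T_n\cdots T_2T_1$ is $\alpha$-firmly nonexpansive with constant $$\alpha:=\Big(1+\frac{1-\alpha_{\max}}{n^{r-1}\alpha_{\max}}\Big)^{-1}.$$ The same relations are fulfilled for quasi $\alpha$-firmly nonexpansive operators $T_1,T_2,\dots,T_n:X\to X$; that is, if each $T_i$ is quasi $\alpha$-firmly nonexpansive with constant $\alpha_i\in(0,1)$, then i) and ii) hold with ''quasi $\alpha$-firmly nonexpansive'' in place of ''$\alpha$-firmly nonexpansive'' and with the same constants.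
   Context: For $r\in[2,\infty)$, a normed space $(X,\|\cdot\|)$ is called $r$-uniformly convex (with constant $c_r$) if there is a constant $c_r>0$ such that for all $w\in[0,1]$ and all $x,y\in X$ $$\|(1-w)x+wy\|^r\le(1-w)\|x\|^r+w\|y\|^r-\frac{c_r}{2}w(1-w)\|x-y\|^r.$$ The constant $c_r$ is fixed. Operators are maps $X\to X$, not necessarily linear; $\mathrm{Fix}\,T=\{x\in X:Tx=x\}$; $\mathrm{I}$ is the identity. For $\alpha\in(0,1)$, consider the inequality $$(\ast)\qquad\|Tx-Ty\|^r\le\|x-y\|^r-\frac{c_r}{2}\,\frac{1-\alpha}{\alpha}\,\|(\mathrm{I}-T)x-(\mathrm{I}-T)y\|^r.$$ $T$ is $\alpha$-firmly nonexpansive (with constant $\alpha$) if $(\ast)$ holds for all $x,y\in X$. $T$ is quasi $\alpha$-firmly nonexpansive (with constant $\alpha$) if $\mathrm{Fix}\,T\ne\emptyset$ and $(\ast)$ holds for all $x\in X$ and all $y\in\mathrm{Fix}\,T$.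
   Formalization: In the quasi α-firmly nonexpansive case the operators T_1,…,T_n are additionally assumed to have a common fixed point; without this, both i) and ii) fail, since the average or the composition may have no fixed point. *)

(* Defs.v *)
From HB Require Import structures.
From mathcomp Require Import all_boot all_order all_algebra.
From mathcomp Require Import all_classical all_reals all_analysis.
Set Implicit Arguments.
Unset Strict Implicit.
Unset Printing Implicit Defensive.
Import Order.TTheory GRing.Theory Num.Theory.
Import numFieldNormedType.Exports.
Local Open Scope classical_set_scope.
Local Open Scope ring_scope.

Definition r_uniformly_convex (R : realType) (X : normedModType R) (r c : R)
    : Prop :=
  0 < c /\
  forall (w : R) (x y : X), 0 <= w <= 1 ->
    `|(1 - w) *: x + w *: y| `^ r <=
      (1 - w) * `|x| `^ r + w * `|y| `^ r
      - c / 2 * w * (1 - w) * `|x - y| `^ r.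

Definition Fixpoints (X : Type) (T : X -> X) : set X := [set x | T x = x].

Definition fne_ineq (R : realType) (X : normedModType R) (r c alpha : R)
    (T : X -> X) (x y : X) : Prop :=
  `|T x - T y| `^ r <=
    `|x - y| `^ r
    - c / 2 * ((1 - alpha) / alpha) * `|(x - T x) - (y - T y)| `^ r.

Definition firmly_nonexpansive (R : realType) (X : normedModType R)
    (r c alpha : R) (T : X -> X) : Prop :=
  0 < alpha < 1 /\ forall x y : X, fne_ineq r c alpha T x y.

Definition quasi_firmly_nonexpansive (R : realType) (X : normedModType R)
    (r c alpha : R) (T : X -> X) : Prop :=
  [/\ 0 < alpha < 1,
      Fixpoints T !=set0
    & forall x y : X, Fixpoints T y -> fne_ineq r c alpha T x y].

(* The seed 0 is harmless: this is only used for n > 0 and alpha i > 0. *)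
Definition alpha_max (R : realType) (n : nat) (alpha : 'I_n -> R) : R :=
  \big[Num.max/0]_(i < n) alpha i.

Definition weighted_sum (R : realType) (X : normedModType R) (n : nat)
    (w : 'I_n -> R) (T : 'I_n -> X -> X) : X -> X :=
  fun x => \sum_(i < n) w i *: T i x.

(* T_n ... T_2 T_1 : the operator of smallest index is applied first. *)
Definition composition (X : Type) (n : nat) (T : 'I_n -> X -> X) : X -> X :=
  fun x => foldl (fun y i => T i y) x (enum 'I_n).

Definition composition_constant (R : realType) (n : nat) (r a : R) : R :=
  (1 + (1 - a) / (n%:R `^ (r - 1) * a))^-1.

(* Each operator of a quasi firmly nonexpansive family has a fixed point, but
   the calculus rules also need a common one.  On the real line with r = 2 and
   c = 2, let T1 be 0 except that T1 (1/2) = 1/4, and let T2 be constantly 1.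
   Both are quasi firmly nonexpansive with constant 1/2, but (T1 + T2) / 2 has
   no fixed point. Likewise for T2 \o T1 when T1 x = x / 2 and T2 x = (x+1) / 2
   except that T2 (1/3) = 1/2. *)
Definition have_common_fixpoint (X : Type) (n : nat) (T : 'I_n -> X -> X)
    : Prop :=
  exists z : X, forall i, Fixpoints (T i) z.

(* Main.v *)
Require Import Defs.
From HB Require Import structures.
From mathcomp Require Import all_boot all_order all_algebra.
From mathcomp Require Import all_classical all_reals all_analysis.
From mathcomp Require Import ring lra.
Set Implicit Arguments.
Unset Strict Implicit.
Unset Printing Implicit Defensive.
Import Order.TTheory GRing.Theory Num.Theory.
Import numFieldNormedType.Exports.
Local Open Scope classical_set_scope.
Local Open Scope ring_scope.

(** All operators may be given the common constant [a := alpha_max alpha],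
    because the penalty [c / 2 * ((1 - a) / a)] in the defining inequality is
    nonincreasing in [a] ([fne_ineq_le]).  Both rules then follow from
    convexity of the [r]-th power of the norm.

    For a weighted sum, Jensen's inequality ([normr_convex_powR]) bounds
    [`|T x - T y| `^ r] by the average of the [`|T i x - T i y| `^ r], hence by
    [`|x - y| `^ r] minus the average of the penalties
    ([weighted_sum_decrease]).  A second use of Jensen's inequality bounds that
    average below by the penalty of the averaged displacement.

    For a composition, the inequalities of the successive steps telescope
    ([foldl_decrease]) and leave a sum of [n] penalties, one for each gap
    between the displacements of the two orbits.  The gaps add up to
    [(x - T x) - (y - T y)] ([sum_step_gaps]), so Jensen's inequality with
    equal weights ([normr_sum_powR]) bounds the sum of their [r]-th powers
    below, at the cost of a factor [n `^ (r - 1)]; the composition constant is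
    chosen to absorb it ([fne_penalty_composition_constant]).

    In the quasi case the same estimates apply as soon as every fixed point
    [y] of the new operator is fixed by the given ones.  Let [z] be a common
    fixed point.  As the new operator fixes both [y] and [z], the estimates
    before the final use of Jensen's inequality read [B <= B - P] with
    [B = `|y - z| `^ r] and [P] a sum of nonnegative penalties, so all
    penalties vanish and [y] is fixed by each operator of positive weight
    ([weighted_sum_fixed]), respectively by each factor of the composition
    ([composition_fixed]). *)

(** * Convexity of powers of the norm *)

(** The power function lies above its tangent at [m].  This is Young's
    inequality for the exponents [r] and [r / (r - 1)], applied to the pair
    [t], [m `^ (r - 1)]. *)
Lemma powR_tangent (R : realType) (r m t : R) : 1 < r -> 0 <= m -> 0 <= t ->
  r * m `^ (r - 1) * t - (r - 1) * m `^ r <= t `^ r.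
Proof.
move=> r1 m0 t0.
have r0 : 0 < r by lra.
have rB1 : 0 < r - 1 by lra.
have := @conjugate_powR _ t (m `^ (r - 1)) r (r / (r - 1)) t0 (powR_ge0 _ _) r0.
rewrite divr_gt0// -powRrM mulrCA mulfV ?gt_eqF// mulr1 => /(_ isT).
have -> : r^-1 + (r / (r - 1))^-1 = 1.
  by field; apply/andP; split; rewrite gt_eqF.
move=> /(_ erefl) young.
have := ler_wpM2l (ltW r0) young.
have -> : r * (t `^ r / r + m `^ r / (r / (r - 1))) =
    t `^ r + (r - 1) * m `^ r by field; apply/andP; split; rewrite gt_eqF.
by rewrite mulrAC mulrA; lra.
Qed.

(** Jensen's inequality.  By the triangle inequality it suffices to treat the
    average [m] of the norms, and averaging the tangent inequalities at [m]
    cancels their linear terms. *)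
Lemma normr_convex_powR (R : realType) (X : normedModType R) (r : R)
    (I : Type) (s : seq I) (w : I -> R) (v : I -> X) :
  1 < r -> (forall i, 0 <= w i) -> \sum_(i <- s) w i = 1 ->
  `|\sum_(i <- s) w i *: v i| `^ r <= \sum_(i <- s) w i * `|v i| `^ r.
Proof.
move=> r1 w0 w1.
set m := \sum_(i <- s) w i * `|v i|.
have m0 : 0 <= m by apply: sumr_ge0 => i _; rewrite mulr_ge0.
have triangle : `|\sum_(i <- s) w i *: v i| <= m.
  apply: le_trans (ler_norm_sum _ _ _) _.
  by apply: ler_sum => i _; rewrite normrZ ger0_norm.
apply: (@le_trans _ _ (m `^ r)).
  by apply: ge0_ler_powR; rewrite ?nnegrE//; lra.
have -> : m `^ r = \sum_(i <- s)
    w i * (r * m `^ (r - 1) * `|v i| - (r - 1) * m `^ r).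
  under eq_bigr do rewrite mulrBr mulrCA.
  rewrite big_split/= sumrN -mulr_suml -mulr_sumr w1 -/m.
  by rewrite -!(mulr_powRB1 m0 (_ : 0 < r)); [ring|lra].
by apply: ler_sum => i _; rewrite ler_wpM2l// powR_tangent.
Qed.

(** Jensen's inequality with equal weights, cleared of denominators; it is the
    source of the factor [n `^ (r - 1)] in the constant of a composition. *)
Lemma normr_sum_powR (R : realType) (X : normedModType R) (r : R)
    (s : seq X) : 1 < r -> (0 < size s)%N ->
  `|\sum_(v <- s) v| `^ r <=
    (size s)%:R `^ (r - 1) * \sum_(v <- s) `|v| `^ r.
Proof.
move=> r1 s0; set N : R := (size s)%:R.
have N0 : 0 < N by rewrite ltr0n.
have -> : \sum_(v <- s) v = N *: \sum_(v <- s) N^-1 *: v.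
  by rewrite -scaler_sumr scalerA mulfV ?gt_eqF// scale1r.
rewrite normrZ (ger0_norm (ltW N0)) powRM ?(ltW N0)//.
rewrite -(mulr_powRB1 (ltW N0) (_ : 0 < r)); last lra.
rewrite -mulrA mulrCA ler_wpM2l ?powR_ge0//.
rewrite -ler_pdivlMl// mulr_sumr.
apply: (normr_convex_powR id (w := fun=> N^-1)) => //.
  by move=> _; rewrite invr_ge0 ltW.
by rewrite big_const_seq count_predT iter_addr_0 -[_ *+ _]mulr_natr mulVf
  ?gt_eqF.
Qed.

(** * The penalty coefficient *)

Definition fne_penalty (R : realType) (c a : R) : R := c / 2 * ((1 - a) / a).

Lemma fne_penalty_gt0 (R : realType) (c a : R) :
  0 < c -> 0 < a < 1 -> 0 < fne_penalty c a.
Proof.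
by move=> c0 /andP[a0 a1]; rewrite mulr_gt0 ?divr_gt0// subr_gt0.
Qed.

(** The penalty decreases in the constant, so operators with different
    constants can be treated as sharing the largest one. *)
Lemma fne_ineq_le (R : realType) (X : normedModType R) (r c a b : R)
    (f : X -> X) (x y : X) : 0 < c -> 0 < a <= b ->
  fne_ineq r c a f x y -> fne_ineq r c b f x y.
Proof.
move=> c0 /andP[a0 ab] Ha; apply: le_trans Ha _.
have b0 := lt_le_trans a0 ab.
rewrite lerB// ler_wpM2r ?powR_ge0// ler_wpM2l ?divr_ge0 ?(ltW c0)//.
by rewrite !mulrBl !mul1r !divff ?gt_eqF// lerB// lef_pV2 ?posrE.
Qed.

Lemma composition_constant01 (R : realType) (n : nat) (r a : R) :
  (0 < n)%N -> 0 < a < 1 -> 0 < composition_constant n r a < 1.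
Proof.
move=> n0 /andP[a0 a1].
have q0 : 0 < (1 - a) / (n%:R `^ (r - 1) * a).
  by rewrite divr_gt0 ?subr_gt0// mulr_gt0// powR_gt0 ?ltr0n.
rewrite invr_gt0 invf_lt1; lra.
Qed.

(** The composition constant is the one whose penalty is that of [a] divided by
    [n `^ (r - 1)]. *)
Lemma fne_penalty_composition_constant (R : realType) (n : nat) (r c a : R) :
  (0 < n)%N -> 0 < a < 1 ->
  fne_penalty c (composition_constant n r a) * n%:R `^ (r - 1) =
    fne_penalty c a.
Proof.
move=> n0 a01; have /andP[k0 _] := composition_constant01 r n0 a01.
have /andP[a0 _] := a01.
have N0 : n%:R `^ (r - 1) != 0 :> R by rewrite gt_eqF// powR_gt0 ?ltr0n.
rewrite /fne_penalty mulrBl mul1r divff ?gt_eqF// invrK.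
by field; rewrite N0 gt_eqF.
Qed.

(** * Weighted sums *)

Lemma weighted_sum_displacement (R : realType) (X : normedModType R) (n : nat)
    (w : 'I_n -> R) (T : 'I_n -> X -> X) (x : X) : \sum_(i < n) w i = 1 ->
  x - weighted_sum w T x = \sum_(i < n) w i *: (x - T i x).
Proof.
move=> w1; under eq_bigr do rewrite scalerBr.
by rewrite big_split/= sumrN -scaler_suml w1 scale1r.
Qed.

(** The penalties of the individual operators are kept apart here, rather than
    merged into the penalty of the average: the separate terms are what
    identifies the fixed points of the average.  The inequality is assumed for
    the operators of positive weight only, because in the quasi nonexpansive
    case [y] is a fixed point of the average and an operator of weight zero may
    move it. *)
Lemma weighted_sum_decrease (R : realType) (X : normedModType R) (r c a : R)
    (n : nat) (w : 'I_n -> R) (T : 'I_n -> X -> X) (x y : X) :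
  1 < r -> (forall i, 0 <= w i) -> \sum_(i < n) w i = 1 ->
  (forall i, 0 < w i -> fne_ineq r c a (T i) x y) ->
  `|weighted_sum w T x - weighted_sum w T y| `^ r <= `|x - y| `^ r -
    fne_penalty c a *
      \sum_(i < n) w i * `|(x - T i x) - (y - T i y)| `^ r.
Proof.
move=> r1 w0 w1 Tne.
have -> : weighted_sum w T x - weighted_sum w T y =
    \sum_(i < n) w i *: (T i x - T i y).
  by rewrite -sumrB; apply: eq_bigr => i _; rewrite scalerBr.
apply: le_trans (normr_convex_powR _ r1 w0 w1) _.
have -> : `|x - y| `^ r = \sum_(i < n) w i * `|x - y| `^ r.
  by rewrite -mulr_suml w1 mul1r.
rewrite mulr_sumr -sumrB; apply: ler_sum => i _.
rewrite mulrCA -mulrBr.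
have [<-|wi0] := eqVneq 0 (w i); first by rewrite !mul0r.
by rewrite ler_wpM2l// Tne// lt_neqAle wi0 w0.
Qed.

Lemma weighted_sum_fne_ineq (R : realType) (X : normedModType R) (r c a : R)
    (n : nat) (w : 'I_n -> R) (T : 'I_n -> X -> X) (x y : X) :
  1 < r -> 0 < c -> 0 < a < 1 ->
  (forall i, 0 <= w i) -> \sum_(i < n) w i = 1 ->
  (forall i, 0 < w i -> fne_ineq r c a (T i) x y) ->
  fne_ineq r c a (weighted_sum w T) x y.
Proof.
move=> r1 c0 a01 w0 w1 Tne.
apply: le_trans (weighted_sum_decrease r1 w0 w1 Tne) _.
rewrite lerB// ler_wpM2l ?(ltW (fne_penalty_gt0 c0 a01))//.
rewrite !weighted_sum_displacement// -sumrB.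
under eq_bigr do rewrite -scalerBr.
exact: normr_convex_powR.
Qed.

Lemma weighted_sum_common_fixed (R : realType) (X : normedModType R) (n : nat)
    (w : 'I_n -> R) (T : 'I_n -> X -> X) (z : X) : \sum_(i < n) w i = 1 ->
  (forall i, Fixpoints (T i) z) -> Fixpoints (weighted_sum w T) z.
Proof.
move=> w1 Tz; rewrite /Fixpoints/= -[RHS]scale1r -w1 scaler_suml.
by apply: eq_bigr => i _; rewrite Tz.
Qed.

(** Comparing [y] with a common fixed point [z] puts [`|y - z| `^ r] on both
    sides of the decrease estimate, so the weighted sum of the penalties is
    nonpositive and each of its terms vanishes.  Indices of weight zero are
    out of reach: the average does not see their operators. *)
Lemma weighted_sum_fixed (R : realType) (X : normedModType R) (r c a : R)
    (n : nat) (w : 'I_n -> R) (T : 'I_n -> X -> X) (y z : X) :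
  1 < r -> 0 < c -> 0 < a < 1 ->
  (forall i, 0 <= w i) -> \sum_(i < n) w i = 1 ->
  (forall i, Fixpoints (T i) z) ->
  (forall i, 0 < w i -> fne_ineq r c a (T i) y z) ->
  Fixpoints (weighted_sum w T) y -> forall i, 0 < w i -> Fixpoints (T i) y.
Proof.
move=> r1 c0 a01 w0 w1 Tz Tne Ty i wi0.
have := weighted_sum_decrease r1 w0 w1 Tne.
rewrite (weighted_sum_common_fixed w1 Tz).
rewrite Ty lerDl oppr_ge0 pmulr_rle0 ?fne_penalty_gt0// => sum_le0.
have terms_ge0 j : true -> 0 <= w j * `|y - T j y - (z - T j z)| `^ r.
  by move=> _; rewrite mulr_ge0 ?powR_ge0.
have /eqP : \sum_(j < n) w j * `|y - T j y - (z - T j z)| `^ r = 0.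
  by apply/le_anti; rewrite sum_le0 sumr_ge0.
rewrite psumr_eq0// => /allP/(_ i (mem_index_enum _)).
rewrite mulf_eq0 gt_eqF//= powR_eq0 => /andP[+ _].
by rewrite Tz subrr subr0 normr_eq0 subr_eq0 => /eqP.
Qed.

(** * Compositions *)

(** When the operators indexed by [s] are applied successively to [x] and to
    [y], each application displaces both orbits; the entries record by how much
    the two displacements differ at each step. *)
Fixpoint step_gaps (R : realType) (X : normedModType R) (I : Type)
    (T : I -> X -> X) (s : seq I) (x y : X) : seq X :=
  if s is i :: s' then
    (x - T i x) - (y - T i y) :: step_gaps T s' (T i x) (T i y)
  else [::].

Lemma size_step_gaps (R : realType) (X : normedModType R) (I : Type)
    (T : I -> X -> X) (s : seq I) (x y : X) :
  size (step_gaps T s x y) = size s.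
Proof. by elim: s x y => //= i s IHs x y; rewrite IHs. Qed.

Lemma sum_step_gaps (R : realType) (X : normedModType R) (I : Type)
    (T : I -> X -> X) (s : seq I) (x y : X) :
  let F := foldl (fun z i => T i z) in
  \sum_(v <- step_gaps T s x y) v = (x - F x s) - (y - F y s).
Proof.
elim: s x y => [|i s IHs] x y /=; first by rewrite big_nil !subrr.
by rewrite big_cons IHs addrACA -opprD !addrA !subrK.
Qed.

(** The one-step inequalities telescope along the two orbits.  The set [D]
    holds the orbit of [y], where the inequalities are needed: the whole space
    for firmly nonexpansive operators, the common fixed points for quasi firmly
    nonexpansive ones. *)
Lemma foldl_decrease (R : realType) (X : normedModType R) (r c a : R)
    (I : Type) (T : I -> X -> X) (D : set X) (s : seq I) (x y : X) :
  (forall i z, D z -> D (T i z)) ->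
  (forall i x z, D z -> fne_ineq r c a (T i) x z) -> D y ->
  `|foldl (fun z i => T i z) x s - foldl (fun z i => T i z) y s| `^ r <=
    `|x - y| `^ r -
    fne_penalty c a * \sum_(v <- step_gaps T s x y) `|v| `^ r.
Proof.
move=> DT Tne; elim: s x y => [|i s IHs] x y Dy /=.
  by rewrite big_nil mulr0 subr0.
apply: le_trans (IHs _ _ (DT i _ Dy)) _.
by rewrite big_cons mulrDr opprD addrA lerB//; exact: Tne.
Qed.

Lemma composition_fne_ineq (R : realType) (X : normedModType R) (r c a : R)
    (n : nat) (T : 'I_n -> X -> X) (D : set X) (x y : X) :
  1 < r -> 0 < c -> 0 < a < 1 -> (0 < n)%N ->
  (forall i z, D z -> D (T i z)) ->
  (forall i x z, D z -> fne_ineq r c a (T i) x z) -> D y ->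
  fne_ineq r c (composition_constant n r a) (composition T) x y.
Proof.
move=> r1 c0 a01 n0 DT Tne Dy.
have k01 := composition_constant01 r n0 a01.
apply: le_trans (foldl_decrease (enum 'I_n) x DT Tne Dy) _.
rewrite lerB// -(fne_penalty_composition_constant r c n0 a01) -[leRHS]mulrA.
rewrite ler_wpM2l ?(ltW (fne_penalty_gt0 c0 k01))// -sum_step_gaps.
have sz : size (step_gaps T (enum 'I_n) x y) = n.
  by rewrite size_step_gaps size_enum_ord.
rewrite -[X in X%:R]sz.
by apply: normr_sum_powR; rewrite ?sz.
Qed.

(** Since [z] does not move, a vanishing gap says that the corresponding step
    fixes the orbit of [y], which therefore never leaves [y]. *)
Lemma foldl_fixed_of_step_gaps (R : realType) (X : normedModType R)
    (I : eqType) (T : I -> X -> X) (s : seq I) (y z : X) :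
  (forall i, Fixpoints (T i) z) -> {in step_gaps T s y z, forall v, v = 0} ->
  forall i, i \in s -> Fixpoints (T i) y.
Proof.
move=> Tz; elim: s => //= j s IHs.
rewrite Tz subrr subr0 => gaps0.
have Tjy : T j y = y.
  by apply/esym/subr0_eq/gaps0; rewrite mem_head.
move=> i; rewrite inE => /predU1P[->//|]; apply: IHs => v vs.
by apply: gaps0; rewrite inE Tjy vs orbT.
Qed.

Lemma foldl_fixed (X : Type) (I : eqType) (T : I -> X -> X) (s : seq I) (z : X) :
  (forall i, i \in s -> T i z = z) -> foldl (fun y i => T i y) z s = z.
Proof.
elim: s => //= i s IHs Tz; rewrite Tz ?mem_head// IHs// => j js.
by rewrite Tz// inE js orbT.
Qed.

(** As for weighted sums, comparison with a common fixed point [z] forces every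
    penalty in the telescoped estimate to vanish. *)
Lemma composition_fixed (R : realType) (X : normedModType R) (r c a : R)
    (n : nat) (T : 'I_n -> X -> X) (y z : X) :
  0 < c -> 0 < a < 1 -> (forall i, Fixpoints (T i) z) ->
  (forall i x, fne_ineq r c a (T i) x z) ->
  Fixpoints (composition T) y -> forall i, Fixpoints (T i) y.
Proof.
move=> c0 a01 Tz Tne Ty i.
have Dz (j : 'I_n) x : [set z] x -> [set z] (T j x) by move=> ->; exact: Tz.
have TneD j x t : [set z] t -> fne_ineq r c a (T j) x t by move=> ->.
have := foldl_decrease (enum 'I_n) y Dz TneD erefl.
rewrite (foldl_fixed (z := z)); last by move=> j _; exact: Tz.
rewrite [foldl _ _ _]Ty lerDl oppr_ge0 pmulr_rle0 ?fne_penalty_gt0// => sum_le0.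
have /eqP : \sum_(v <- step_gaps T (enum 'I_n) y z) `|v| `^ r = 0.
  by apply/le_anti; rewrite sum_le0 sumr_ge0// => v _; exact: powR_ge0.
rewrite psumr_eq0 => [/allP gaps0|v _]; last exact: powR_ge0.
apply: (foldl_fixed_of_step_gaps Tz (s := enum 'I_n)); last by rewrite mem_enum.
by move=> v /gaps0 /=; rewrite powR_eq0 => /andP[]; rewrite normr_eq0 => /eqP.
Qed.

(** * The calculus rules *)

Lemma alpha_max_lt1 (R : realType) (n : nat) (alpha : 'I_n -> R) :
  (forall i, alpha i < 1) -> alpha_max alpha < 1.
Proof. by move=> alpha1; apply: bigmax_lt. Qed.

Lemma le_alpha_max (R : realType) (n : nat) (alpha : 'I_n -> R) (i : 'I_n) :
  alpha i <= alpha_max alpha.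
Proof. exact: le_bigmax_cond. Qed.

Theorem proposition3p3 (R : realType) (X : normedModType R) (r c : R)
    (hr : 2 <= r) (hX : r_uniformly_convex X r c)
    (n : nat) (hn : (0 < n)%N) (T : 'I_n -> X -> X)
    (alpha w : 'I_n -> R)
    (halpha : forall i, 0 < alpha i < 1)
    (hw : forall i, 0 <= w i <= 1) (hw1 : \sum_(i < n) w i = 1) :
  ((forall i, firmly_nonexpansive r c (alpha i) (T i)) ->
     firmly_nonexpansive r c (alpha_max alpha) (weighted_sum w T) /\
     firmly_nonexpansive r c (composition_constant n r (alpha_max alpha))
       (composition T)) /\
  ((forall i, quasi_firmly_nonexpansive r c (alpha i) (T i)) ->
   have_common_fixpoint T ->
     quasi_firmly_nonexpansive r c (alpha_max alpha) (weighted_sum w T) /\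
     quasi_firmly_nonexpansive r c (composition_constant n r (alpha_max alpha))
       (composition T)).
Proof.
have r1 : 1 < r by lra.
have [c0 _] := hX.
have w0 i : 0 <= w i by case/andP: (hw i).
set a := alpha_max alpha.
have a01 : 0 < a < 1.
  rewrite alpha_max_lt1 ?andbT => [|i]; last by case/andP: (halpha i).
  have /andP[alpha0 _] := halpha (Ordinal hn).
  exact: lt_le_trans alpha0 (le_alpha_max _ _).
have k01 := composition_constant01 r hn a01.
have to_max i x y : fne_ineq r c (alpha i) (T i) x y ->
    fne_ineq r c a (T i) x y.
  apply: fne_ineq_le => //; rewrite le_alpha_max andbT.
  by case/andP: (halpha i).
split=> [Tfne|Tqfne [z Tz]].
  have Tne i x y : fne_ineq r c a (T i) x y by apply/to_max; case: (Tfne i).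
  split; split=> // x y.
    exact: weighted_sum_fne_ineq.
  exact: (composition_fne_ineq (D := setT)).
have Tne i x y : Fixpoints (T i) y -> fne_ineq r c a (T i) x y.
  by case: (Tqfne i) => _ _ Tneq Ty; apply/to_max/Tneq.
split; split=> //.
- by exists z; exact: weighted_sum_common_fixed.
- move=> x y Ty.
  have Tiy := weighted_sum_fixed r1 c0 a01 w0 hw1 Tz
    (fun i _ => Tne i y z (Tz i)) Ty.
  by apply: weighted_sum_fne_ineq => // i /Tiy; exact: Tne.
- by exists z; apply: (foldl_fixed (X := X)) => i _; exact: Tz.
- move=> x y Ty.
  have Tiy := composition_fixed c0 a01 Tz (fun i x => Tne i x z (Tz i)) Ty.
  apply: (composition_fne_ineq
    (D := [set t | forall i, Fixpoints (T i) t])) => //.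
  - by move=> i t Tt j; rewrite (Tt i).
  - by move=> i x' t Tt; apply: Tne.
Qed.
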